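(* Let $0<\alpha\le 1$, let $0\le a<b\le\infty$, let $t_0\in(a,b)$ and $y_0\in\mathbb{R}$, and let $p,q:(a,b)\to\mathbb{R}$ be functions such that $t\mapsto t^{\alpha-1}p(t)$ and $t\mapsto t^{\alpha-1}q(t)$ are continuous on $(a,b)$. Then the initial value problem $$T_\alpha y(t)+p(t)y(t)=q(t)\quad (t\in(a,b)),\qquad y(t_0)=y_0,$$ has a unique solution $y$ on the interval $(a,b)$, where a solution is an $\alpha$-differentiable function $y:(a,b)\to\mathbb{R}$ satisfying the equation at every point of $(a,b)$ together with the initial condition.
   Context: For $0<\alpha\le 1$ and a real-valued function $f$ defined on an interval $(a,b)\subseteq(0,\infty)$, the conformable fractional derivative of $f$ of order $\alpha$ at $t\in(a,b)$ is $$T_\alpha f(t)=\lim_{\varepsilon\to 0}\frac{f(t+\varepsilon t^{1-\alpha})-f(t)}{\varepsilon},$$ whenever this limit exists (as a real number). $f$ is $\alpha$-differentiable on $(a,b)$ if the limit exists at every $t\in(a,b)$. *)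

(* Defs.v *)
From Stdlib Require Import Reals.
From Coquelicot Require Import Coquelicot.

Open Scope R_scope.

Definition in_open (a : R) (b : Rbar) (t : R) : Prop := a < t /\ Rbar_lt t b.

(* Functions on (a,b) are represented by total functions R -> R whose values
   outside (a,b) are irrelevant: (a,b) is open, so the limit below at a point
   of (a,b) only involves values taken on (a,b).  The limit is only meant to be
   used at t > 0, where Rpower t (1 - alpha) is the usual real power. *)
Definition conf_quotient (alpha : R) (f : R -> R) (t eps : R) : R :=
  (f (t + eps * Rpower t (1 - alpha)) - f t) / eps.

Definition ex_conf_derive (alpha : R) (f : R -> R) (t : R) : Prop :=
  ex_finite_lim (conf_quotient alpha f t) 0.

(* Like Coquelicot's Derive, this is meaningful only under ex_conf_derive. *)
Definition conf_derive (alpha : R) (f : R -> R) (t : R) : R :=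
  real (Lim (conf_quotient alpha f t) 0).

Definition alpha_differentiable_on
    (alpha a : R) (b : Rbar) (f : R -> R) : Prop :=
  forall t : R, in_open a b t -> ex_conf_derive alpha f t.

Definition is_ivp_solution
    (alpha a : R) (b : Rbar) (p q : R -> R) (t0 y0 : R) (y : R -> R) : Prop :=
  alpha_differentiable_on alpha a b y /\
  (forall t : R, in_open a b t ->
     conf_derive alpha y t + p t * y t = q t) /\
  y t0 = y0.

(* Main.v *)
(** At [t > 0] the substitution [h = eps * t^(1-alpha)] turns the conformable
    quotient into a rescaled Newton quotient, so [T_alpha f t = l] means
    [f'(t) = t^(alpha-1) * l].  The problem becomes the linear equation
    [y' + A y = B] with [A = t^(alpha-1) p] and [B = t^(alpha-1) q] continuous.
    For the integrating factor [exp P], [P' = A], this says that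
    [(exp P * y)' = exp P * B], which determines [exp P * y] up to a constant. *)

Require Import Defs.
From Stdlib Require Import Reals Lra.
From Coquelicot Require Import Coquelicot.

Open Scope R_scope.

Lemma Rpower_sub_inv (alpha t : R) :
  Rpower t (alpha - 1) * Rpower t (1 - alpha) = 1.
Proof.
rewrite <- Rpower_plus.
replace (alpha - 1 + (1 - alpha)) with 0 by ring.
unfold Rpower; rewrite Rmult_0_l; exact exp_0.
Qed.

(** Since [c] is nonzero, [h = eps * c] is a bijection fixing 0. Radii and error bounds both scale
    by [Rabs c], so each epsilon-delta statement translates into the other. *)
Lemma is_derive_lim_quotient (f : R -> R) (t c l : R) : c <> 0 ->
  is_lim (fun eps => (f (t + eps * c) - f t) / eps) 0 (c * l) <->
  is_derive f t l.
Proof.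
intros Hc; assert (Hac := Rabs_pos_lt c Hc).
rewrite is_derive_Reals; rewrite <- is_lim_spec; split.
- intros H e He.
  assert (Hce : 0 < Rabs c * e) by nra.
  destruct (H (mkposreal _ Hce)) as [d Hd]; simpl in Hd.
  assert (Hdc : 0 < d * Rabs c) by (destruct d; simpl; nra).
  exists (mkposreal _ Hdc); simpl; intros h Hh Hhd.
  assert (Hn : h / c <> 0)
    by (intro E; apply Hh; replace h with (h / c * c) by (field; exact Hc);
        rewrite E; ring).
  assert (Hb : ball 0 d (h / c)).
  { change (Rabs (h / c - 0) < d); rewrite Rminus_0_r, Rabs_div by exact Hc.
    apply Rmult_lt_reg_r with (Rabs c); [exact Hac|].
    replace (Rabs h / Rabs c * Rabs c) with (Rabs h) by (field; lra).
    exact Hhd. }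
  specialize (Hd _ Hb Hn).
  replace (h / c * c) with h in Hd by (field; exact Hc).
  apply Rmult_lt_reg_l with (Rabs c); [exact Hac|].
  rewrite <- Rabs_mult.
  replace (c * ((f (t + h) - f t) / h - l))
    with ((f (t + h) - f t) / (h / c) - c * l) by (field; auto).
  exact Hd.
- intros H e.
  assert (He : 0 < e / Rabs c) by (apply Rdiv_lt_0_compat; [apply cond_pos|lra]).
  destruct (H _ He) as [d Hd].
  assert (Hdc : 0 < d / Rabs c) by (apply Rdiv_lt_0_compat; [apply cond_pos|lra]).
  exists (mkposreal _ Hdc); simpl; intros x Hb Hx.
  change (Rabs (x - 0) < d / Rabs c) in Hb; rewrite Rminus_0_r in Hb.
  assert (Hxc : x * c <> 0) by (apply Rmult_integral_contrapositive; auto).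
  assert (Hlt : Rabs (x * c) < d).
  { rewrite Rabs_mult; replace (pos d) with (d / Rabs c * Rabs c) by (field; lra).
    apply Rmult_lt_compat_r; assumption. }
  specialize (Hd _ Hxc Hlt).
  replace ((f (t + x * c) - f t) / x - c * l)
    with (c * ((f (t + x * c) - f t) / (x * c) - l)) by (field; auto).
  rewrite Rabs_mult.
  replace (pos e) with (Rabs c * (e / Rabs c)) by (field; lra).
  apply Rmult_lt_compat_l; assumption.
Qed.

Lemma is_lim_conf_quotient (alpha : R) (f : R -> R) (t l : R) :
  is_lim (conf_quotient alpha f t) 0 l <->
  is_derive f t (Rpower t (alpha - 1) * l).
Proof.
(* [Rpower] unfolds to an exponential, so the scale factor is nonzero. *)
assert (Hc : Rpower t (1 - alpha) <> 0)
  by (apply Rgt_not_eq; unfold Rpower; apply exp_pos).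
rewrite <- (is_derive_lim_quotient f t _ _ Hc).
replace (Rpower t (1 - alpha) * (Rpower t (alpha - 1) * l)) with l.
- reflexivity.
- rewrite <- Rmult_assoc, (Rmult_comm (Rpower t (1 - alpha))), Rpower_sub_inv.
  ring.
Qed.

(** Uniqueness of limits turns [conf_derive] into the actual limit once existence is known.
    Existence and equation thus merge into one [is_derive] fact, the form in which the classical
    linear equation is solved below. *)
Lemma conf_equation_iff_is_derive (alpha p q : R) (y : R -> R) (t : R) :
  (ex_conf_derive alpha y t /\ conf_derive alpha y t + p * y t = q) <->
  is_derive y t
    (Rpower t (alpha - 1) * q - Rpower t (alpha - 1) * p * y t).
Proof.
replace (Rpower t (alpha - 1) * q - Rpower t (alpha - 1) * p * y t)
  with (Rpower t (alpha - 1) * (q - p * y t)) by ring.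
rewrite <- is_lim_conf_quotient.
unfold ex_conf_derive, conf_derive; split.
- intros [[l Hl] E]; rewrite (is_lim_unique _ _ _ Hl) in E; simpl in E.
  replace (q - p * y t) with l by lra; exact Hl.
- intros H; split; [eexists; exact H|].
  rewrite (is_lim_unique _ _ _ H); simpl; ring.
Qed.

Lemma locally_in_open (a : R) (b : Rbar) (t : R) :
  in_open a b t -> locally t (in_open a b).
Proof.
intros [Ha Hb]; apply filter_and.
- exact (open_gt a t Ha).
- destruct b as [b| |]; simpl in *.
  + exact (open_lt b t Hb).
  + now apply filter_forall.
  + contradiction.
Qed.

(** Convexity, phrased with [Rmin] and [Rmax] to fit integrals and the mean value theorem with
    endpoints in either order. *)
Lemma in_open_between (a : R) (b : Rbar) (s t x : R) :
  in_open a b s -> in_open a b t -> Rmin s t <= x <= Rmax s t -> in_open a b x.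
Proof.
intros [Has Hsb] [Hat Htb] [H1 H2]; split.
- apply Rlt_le_trans with (2 := H1); apply Rmin_glb_lt; assumption.
- apply Rbar_le_lt_trans with (Rmax s t); [exact H2|].
  unfold Rmax; destruct (Rle_dec s t); assumption.
Qed.

(** The fundamental theorem asks for the integral to exist for all [s] near [t]: openness keeps [s]
    in the interval, and convexity keeps the segment from [t0] to [s] there, where [g] is
    continuous. *)
Lemma is_derive_RInt_in_open (a : R) (b : Rbar) (g : R -> R) (t0 : R) :
  in_open a b t0 -> (forall t, in_open a b t -> continuous g t) ->
  forall t, in_open a b t -> is_derive (fun s => RInt g t0 s) t (g t).
Proof.
intros H0 Hg t Ht.
apply (is_derive_RInt g (fun s => RInt g t0 s) t0 t); [|exact (Hg t Ht)].
apply filter_imp with (2 := locally_in_open a b t Ht); intros s Hs.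
apply (RInt_correct g), (ex_RInt_continuous (V := R_CompleteNormedModule)).
intros x Hx; apply Hg, (in_open_between a b t0 s x); assumption.
Qed.

Lemma is_derive_0_in_open_const (a : R) (b : Rbar) (f : R -> R) (s t : R) :
  (forall x, in_open a b x -> is_derive f x 0) ->
  in_open a b s -> in_open a b t -> f t = f s.
Proof.
intros Hf Hs Ht.
destruct (MVT_gen f s t (fun _ => 0)) as [c [_ E]].
- intros x Hx; apply Hf, (in_open_between a b s t x); try assumption; lra.
- intros x Hx; apply continuity_pt_filterlim, (ex_derive_continuous f).
  exists 0; apply Hf, (in_open_between a b s t x); assumption.
- lra.
Qed.

Lemma linear_ode_exists_unique (a : R) (b : Rbar) (A B : R -> R) (t0 y0 : R)
    (ht0 : in_open a b t0)
    (hA : forall t, in_open a b t -> continuous A t)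
    (hB : forall t, in_open a b t -> continuous B t) :
  exists y : R -> R,
    ((forall t, in_open a b t -> is_derive y t (B t - A t * y t)) /\
     y t0 = y0) /\
    (forall z : R -> R,
       (forall t, in_open a b t -> is_derive z t (B t - A t * z t)) ->
       z t0 = y0 -> forall t, in_open a b t -> z t = y t).
Proof.
(* Basing this integral and [Q] below at [t0] makes both vanish there, so the constant of
   integration is [y0] itself. *)
set (P := fun t => RInt A t0 t).
assert (HP : forall t, in_open a b t -> is_derive P t (A t))
  by exact (is_derive_RInt_in_open a b A t0 ht0 hA).
set (g := fun t => exp (P t) * B t).
assert (HE : forall t, in_open a b t ->
          is_derive (fun s => exp (P s)) t (A t * exp (P t))).
{ intros t Ht; apply (is_derive_comp exp P); [apply is_derive_exp|auto]. }
assert (Hg : forall t, in_open a b t -> continuous g t).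
{ intros t Ht; apply (continuous_mult (fun s => exp (P s)) B); [|auto].
  apply (ex_derive_continuous (fun s => exp (P s))); eexists; apply HE, Ht. }
set (Q := fun t => RInt g t0 t).
assert (HQ : forall t, in_open a b t -> is_derive Q t (g t))
  by exact (is_derive_RInt_in_open a b g t0 ht0 Hg).
assert (P0 : P t0 = 0) by exact (RInt_point t0 A).
assert (Q0 : Q t0 = 0) by exact (RInt_point t0 g).
assert (HPinv : forall t, exp (- P t) * exp (P t) = 1)
  by (intro t; rewrite <- exp_plus, Rplus_opp_l; exact exp_0).
(* Variation of constants: [exp P * y] has derivative [g] and value [y0] at [t0], so it must be
   [y0 + Q]. *)
exists (fun t => exp (- P t) * (y0 + Q t)); split; [split|].
- intros t Ht; auto_derive.
  + split; [exists (A t); auto|split; [exists (g t); auto|exact I]].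
  + change (Derive (fun x => P x) t) with (Derive P t).
    change (Derive (fun x => Q x) t) with (Derive Q t).
    rewrite (is_derive_unique _ _ _ (HP t Ht)), (is_derive_unique _ _ _ (HQ t Ht)).
    (* Only the [B t] of the right-hand side is expanded, to match the product of exponentials that
       the derivative of [Q] leaves on the left. *)
    unfold g; replace (B t) with (exp (- P t) * exp (P t) * B t) at 2
      by (rewrite HPinv; ring).
    ring.
- rewrite P0, Q0, Ropp_0, exp_0; ring.
- intros z Hz z0 t Ht.
  (* For any solution [z], the terms in [A] cancel in the derivative of [exp P * z - Q], and [g]
     cancels the rest; its constant value is [y0]. *)
  assert (E : exp (P t) * z t - Q t = exp (P t0) * z t0 - Q t0).
  { apply (is_derive_0_in_open_const a b (fun s => exp (P s) * z s - Q s));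
      try assumption.
    intros x Hx; auto_derive.
    - split; [exists (A x); auto|].
      split; [eexists; apply Hz, Hx|split; [exists (g x); auto|exact I]].
    - change (Derive (fun x => P x) x) with (Derive P x).
      change (Derive (fun x => Q x) x) with (Derive Q x).
      change (Derive (fun x => z x) x) with (Derive z x).
      rewrite (is_derive_unique _ _ _ (HP x Hx)), (is_derive_unique _ _ _ (HQ x Hx)),
        (is_derive_unique _ _ _ (Hz x Hx)).
      unfold g; ring. }
  rewrite P0, Q0, z0, exp_0 in E.
  replace (y0 + Q t) with (exp (P t) * z t) by lra.
  rewrite <- Rmult_assoc, HPinv; ring.
Qed.

Theorem theorem4p1 (alpha a : R) (b : Rbar) (t0 y0 : R) (p q : R -> R)
    (halpha0 : 0 < alpha) (halpha1 : alpha <= 1)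
    (ha : 0 <= a) (hab : Rbar_lt a b) (ht0 : in_open a b t0)
    (hp : forall t : R, in_open a b t ->
       continuous (fun s : R => Rpower s (alpha - 1) * p s) t)
    (hq : forall t : R, in_open a b t ->
       continuous (fun s : R => Rpower s (alpha - 1) * q s) t) :
  exists y : R -> R,
    is_ivp_solution alpha a b p q t0 y0 y /\
    (forall z : R -> R, is_ivp_solution alpha a b p q t0 y0 z ->
       forall t : R, in_open a b t -> z t = y t).
Proof.
(* The coefficients [A] and [B] are inferred from [hp] and [hq]. *)
destruct (linear_ode_exists_unique a b _ _ t0 y0 ht0 hp hq)
  as [y [[Hy Hy0] Huniq]].
exists y; split.
- split; [|split; [|exact Hy0]]; intros t Ht;
    apply (conf_equation_iff_is_derive alpha (p t) (q t) y t); exact (Hy t Ht).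
- intros z [Hd [Hz Hz0]]; apply Huniq; [|exact Hz0]; intros t Ht.
  apply (conf_equation_iff_is_derive alpha (p t) (q t) z t); split.
  + exact (Hd t Ht).
  + exact (Hz t Ht).
Qed.
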